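(* Let $K$ be a field, $d\in\mathbb{N}$, $R=K[x_1,\ldots,x_d]$, and let $G$ be the set of all monomials of $R$. Let $\mathcal{I}(R)$ be the set of all monomial ideals of $R$, partially ordered by $$I\sqsubseteq J\iff \partial\mathrm{oc}(I)\supseteq\partial\mathrm{oc}(J)\ \text{ and }\ I\subseteq J .$$ Then the map $\mathcal{I}(R)\to\mathcal{I}(R)$ sending $I$ to the ideal $\overline{I}$ of $R$ generated by $G\setminus D(\partial\mathrm{oc}(I))$ is a closure operator on the poset $(\mathcal{I}(R),\sqsubseteq)$.
   Context: For a monomial ideal $I$ of $R$ and $\mathfrak{m}=(x_1,\ldots,x_d)$, the docle $\partial\mathrm{oc}(I)$ is the set of monomials in $(I:\mathfrak{m})\setminus I$; i.e. the monomials $a\notin I$ with $x_ia\in I$ for all $i$. $G$ is partially ordered by divisibility, and for $A\subseteq G$, $D(A)$ is the set of monomials dividing some element of $A$. A closure operator on a poset $(Q,\sqsubseteq)$ is a map $q\mapsto\overline{q}$ from $Q$ to $Q$ which is extensive ($q\sqsubseteq\overline{q}$), monotone ($q\sqsubseteq r\Rightarrow\overline{q}\sqsubseteq\overline{r}$) and idempotent ($\overline{\overline{q}}=\overline{q}$). *)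

(* Defs.v *)
From mathcomp Require Import all_boot all_order all_algebra.
From mathcomp Require Import mpoly.
From mathcomp Require Import boolp classical_sets.

Set Implicit Arguments.
Unset Strict Implicit.
Unset Printing Implicit Defensive.

Import GRing.Theory.
Local Open Scope classical_set_scope.
Local Open Scope ring_scope.

(* The ideals of ring_quotient are decidable and proper; the unit ideal has to
   be allowed here. *)
Record is_ideal (R : comPzRingType) (I : set R) : Prop := IsIdeal {
  ideal0 : I 0;
  idealD : forall f g, I f -> I g -> I (f + g);
  idealM : forall r f, I f -> I (r * f) }.

Definition ideal_gen (R : comPzRingType) (S : set R) : set R :=
  [set f | forall I : set R, is_ideal I -> S `<=` I -> I f].

Definition colon (R : comPzRingType) (I J : set R) : set R :=
  [set f | forall g, J g -> I (f * g)].

(* A monomial is represented by its exponent vector a : 'X_{1..d}, 'X_[a] being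
   the corresponding polynomial; the product of monomials is (_ + _)%MM. *)
Definition mnm_dvd (d : nat) (a b : 'X_{1..d}) : Prop :=
  exists c : 'X_{1..d}, b = (a + c)%MM.

Definition divisors_of (d : nat) (A : set 'X_{1..d}) : set 'X_{1..d} :=
  [set a | exists2 b, A b & mnm_dvd a b].

Definition mono_ideal_gen (K : fieldType) (d : nat) (A : set 'X_{1..d}) :
    set {mpoly K[d]} :=
  ideal_gen [set ('X_[a] : {mpoly K[d]}) | a in A].

Record monomial_ideal (K : fieldType) (d : nat) := MonomialIdeal {
  mideal_set :> set {mpoly K[d]};
  mideal_setP : exists A : set 'X_{1..d}, mideal_set = mono_ideal_gen A }.

Definition max_ideal (K : fieldType) (d : nat) : set {mpoly K[d]} :=
  ideal_gen (range (fun i : 'I_d => 'X_i)).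
Arguments max_ideal : clear implicits.

Definition docle (K : fieldType) (d : nat) (I : set {mpoly K[d]}) :
    set 'X_{1..d} :=
  [set a | (colon I (max_ideal K d) `\` I) 'X_[a]].

Definition docle_le (K : fieldType) (d : nat) (I J : monomial_ideal K d) :
    Prop :=
  docle J `<=` docle I /\ I `<=` J.

Definition docle_closure (K : fieldType) (d : nat) (I : monomial_ideal K d) :
    monomial_ideal K d :=
  MonomialIdeal
    (ex_intro (fun A => mono_ideal_gen (~` divisors_of (docle I)) =
                        mono_ideal_gen A)
       (~` divisors_of (docle I)) erefl).

Record closure_operator (Q : Type) (le : Q -> Q -> Prop) (cl : Q -> Q) : Prop :=
  ClosureOperator {
    closure_extensive : forall q, le q (cl q);
    closure_monotone : forall q r, le q r -> le (cl q) (cl r);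
    closure_idempotent : forall q, cl (cl q) = cl q }.

(* Main.v *)
Require Import Defs.
From mathcomp Require Import all_boot all_order all_algebra.
From mathcomp Require Import mpoly.
From mathcomp Require Import boolp classical_sets.
From Corelib Require Relation_Definitions.

(** For an ideal [I], [docle I] is an antichain for divisibility: if [a] is in
    [docle I] and [b] is a proper multiple of [a], then [b] is a multiple of
    some [x_i a] in [I]. Hence [docle I] is the set of maximal elements of
    [D (docle I)]. As [D (docle I)] is closed under divisors, it is exactly the
    set of monomials outside the closure of [I], whose docle is thus the set of
    these maximal elements: [docle (docle_closure I) = docle I]. As the closure
    of [I] depends only on [docle I], and decreases with it, the axioms of a
    closure operator follow. *)

Set Implicit Arguments.
Unset Strict Implicit.
Unset Printing Implicit Defensive.

Import GRing.Theory.
Local Open Scope classical_set_scope.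
Local Open Scope ring_scope.

Section IdealGen.
Variable R : comPzRingType.
Implicit Types (I S : set R).

Lemma ideal_gen_is_ideal S : is_ideal (ideal_gen S).
Proof.
split=> [I [] //|f g Sf Sg I idI SI|r f Sf I idI SI].
  by apply: (idealD idI); [apply: Sf | apply: Sg].
by apply: (idealM idI); apply: Sf.
Qed.

Lemma sub_ideal_gen S : S `<=` ideal_gen S.
Proof. by move=> f Sf I _; apply. Qed.

Lemma ideal_gen_sub S I : is_ideal I -> S `<=` I -> ideal_gen S `<=` I.
Proof. by move=> idI SI f; apply. Qed.

Lemma ideal_gen_mono S1 S2 : S1 `<=` S2 -> ideal_gen S1 `<=` ideal_gen S2.
Proof.
move=> S12; apply: ideal_gen_sub (ideal_gen_is_ideal _) _.
exact: subset_trans S12 (@sub_ideal_gen _).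
Qed.

End IdealGen.

Section Docle.
Variables (K : fieldType) (d : nat).
Implicit Types (a b : 'X_{1..d}) (A : set 'X_{1..d}).
Implicit Types (I : set {mpoly K[d]}) (M N : monomial_ideal K d).

Lemma mnm_dvd_refl a : mnm_dvd a a.
Proof. by exists 0%MM; rewrite addm0. Qed.

Lemma mnm_dvd_trans a b c : mnm_dvd a b -> mnm_dvd b c -> mnm_dvd a c.
Proof. by move=> [u ->] [v ->]; exists (u + v)%MM; rewrite addmA. Qed.

Lemma mnm_dvd_proper a b :
  mnm_dvd a b -> a = b \/ exists i : 'I_d, mnm_dvd (a + U_(i))%MM b.
Proof.
move=> [c ->]; have [->|] := eqVneq c 0%MM; first by left; rewrite addm0.
rewrite -mdeg_eq0 mdegE sum_nat_eq0 negb_forall => /existsP[i /= ci_neq0].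
(* The exponent of [c] at [i] is positive, so one factor [x_i] can pass from the cofactor to [a]. *)
right; exists i, (c - U_(i))%MM.
by rewrite -addmA [(U_(i) + _)%MM]addmC submK // lep1mP.
Qed.

Lemma divisors_of_mono A B : A `<=` B -> divisors_of A `<=` divisors_of B.
Proof. by move=> AB a [b /AB Bb ab]; exists b. Qed.

Lemma divisors_of_dvd A a b : mnm_dvd a b -> divisors_of A b -> divisors_of A a.
Proof. by move=> ab [c Ac bc]; exists c => //; apply: mnm_dvd_trans bc. Qed.

Lemma mideal_is_ideal M : is_ideal M.
Proof. by have [A ->] := mideal_setP M; apply: ideal_gen_is_ideal. Qed.

(** The record also carries a proof, which proof irrelevance discards; antisymmetry and idempotence
    are equalities of such records. *)
Lemma mideal_inj M N : M = N :> set {mpoly K[d]} -> M = N.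
Proof.
case: M N => [S hS] [T hT] /= eST; rewrite {S}eST in hS *.
by congr MonomialIdeal; apply: Prop_irrelevance.
Qed.

Lemma ideal_mnm_dvd I a b : is_ideal I -> mnm_dvd a b -> I 'X_[a] -> I 'X_[b].
Proof. by move=> idI [c ->] Ia; rewrite addmC mpolyXD; apply: idealM. Qed.

(** Each monomial in the support of [r * f] is a multiple of one in the support of [f]. This ideal
    serves as an upper bound for [mono_ideal_gen A]. *)
Lemma msupp_is_ideal A : (forall a b, mnm_dvd a b -> A a -> A b) ->
  is_ideal [set f : {mpoly K[d]} | forall a, a \in msupp f -> A a].
Proof.
move=> upA; split=> [a|f g Af Ag a|r f Af a] /=.
- by rewrite msupp0.
- by move/msuppD_le; rewrite mem_cat => /orP[/Af|/Ag].
move/msuppM_le/allpairsP => [[u v] /= [_ /Af Av ->]].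
by apply: upA Av; exists u; rewrite addmC.
Qed.

Lemma mono_ideal_genP A a : (forall b c, mnm_dvd b c -> A b -> A c) ->
  mono_ideal_gen A ('X_[a] : {mpoly K[d]}) <-> A a.
Proof.
move=> upA; split=> [|Aa]; last by apply: sub_ideal_gen; exists a.
move/(_ _ (msupp_is_ideal upA)); apply; last by rewrite msuppX mem_head.
by move=> _ [b Ab <-] c /=; rewrite msuppX inE => /eqP ->.
Qed.

(** The [g] with ['X_[a] * g] in [I] form an ideal, so testing the variables, which generate the
    maximal ideal, suffices. *)
Lemma docleP I a : is_ideal I ->
  docle I a <-> ~ I 'X_[a] /\ forall i, I 'X_[a + U_(i)].
Proof.
move=> idI; split=> [[Ia Ina]|[Ina Ia]]; split=> //.
  by move=> i; rewrite mpolyXD; apply: Ia; apply: sub_ideal_gen; exists i.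
pose J : set {mpoly K[d]} := [set g | I ('X_[a] * g)].
have idJ : is_ideal J.
  split=> [|f g Jf Jg|r f Jf]; rewrite /J /=.
  - by rewrite mulr0; apply: ideal0.
  - by rewrite mulrDr; apply: idealD.
  - by rewrite mulrCA; apply: idealM.
by apply: (ideal_gen_sub idJ) => _ [i _ <-]; rewrite /J /= -mpolyXD.
Qed.

Lemma docle_closureP M a :
  mideal_set (docle_closure M) 'X_[a] <-> ~ divisors_of (docle M) a.
Proof.
apply: (mono_ideal_genP (A := ~` divisors_of (docle M))).
by move=> b c bc nDb /(divisors_of_dvd bc).
Qed.

Lemma sub_docle_closure M : M `<=` docle_closure M.
Proof.
have idM := mideal_is_ideal M.
have [A defM] := mideal_setP M; rewrite {1}defM.
apply: ideal_gen_sub (mideal_is_ideal _) _ => _ [a Aa <-].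
(* If the generator [a] of [M] divided some [b] in [docle M], then [b] would lie in [M]. *)
apply/docle_closureP => -[b /(docleP _ idM)[nMb _] ab]; apply: nMb.
by apply: ideal_mnm_dvd ab _ => //; rewrite defM; apply: sub_ideal_gen; exists a.
Qed.

Lemma docle_docle_closure M : docle (docle_closure M) = docle M.
Proof.
have idM := mideal_is_ideal M; have idC := mideal_is_ideal (docle_closure M).
apply/seteqP; split=> a.
  move=> /(docleP _ idC)[/docle_closureP/contrapT[b Mb ab] Ca].
  (* If [a] divides [b] properly, some [x_i a] still divides [b] and so lies outside the closure,
     against [Ca]. *)
  have [->//|[i aib]] := mnm_dvd_proper ab.
  by case/docle_closureP: (Ca i); exists b.
move=> Ma; apply/(docleP _ idC); split.
  by apply/docle_closureP; apply; exists a => //; apply: mnm_dvd_refl.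
by move=> i; apply: sub_docle_closure; have [_] := (docleP a idM).1 Ma; apply.
Qed.

Lemma docle_closure_mono M N :
  docle N `<=` docle M -> docle_closure M `<=` docle_closure N.
Proof.
move=> NM; apply: ideal_gen_mono; apply: image_subset.
exact: subsetC (divisors_of_mono NM).
Qed.

End Docle.

Theorem corollary4p6 (K : fieldType) (d : nat) :
  Relation_Definitions.order (monomial_ideal K d) (@docle_le K d) /\
  closure_operator (@docle_le K d) (@docle_closure K d).
Proof.
split; split.
- by move=> M; split.
- move=> M N P [NM MN] [PN NP].
  by split; [apply: subset_trans NM | apply: subset_trans NP].
- by move=> M N [_ MN] [_ NM]; apply: mideal_inj; apply/seteqP.
- by move=> M; split; [rewrite docle_docle_closure | apply: sub_docle_closure].
- move=> M N [NM _]; split; last exact: docle_closure_mono.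
  by rewrite !docle_docle_closure.
(* The closure is built from the docle alone, which closing leaves unchanged. *)
- by move=> M; apply: mideal_inj; rewrite /= docle_docle_closure.
Qed.
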